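(* Let $\Gamma$ be a finite subgroup of $\mathbf{SL}_3(\mathbb{C})$ with generalized Cartan matrix $C_\Gamma$ and set of simple reflections $\mathcal{S}=\{s_0,\dots,s_l\}$. Let $\mathcal{S}=S_0\sqcup\dots\sqcup S_{p-1}$ be a decomposition, with $p$ minimal, such that within each $S_r$ the simple roots corresponding to the reflections are mutually orthogonal (i.e. $(C_\Gamma)_{ij}=0$ whenever $s_i,s_j\in S_r$ and $i\neq j$). Let $\tau_r$ denote the (commutative) product of the elements of $S_r$. Then $$C_\Gamma=p\,I-\sum_{k=0}^{p-1}\tau_k .$$
   Context: $\gamma_0,\dots,\gamma_l$ are representatives of the equivalence classes of irreducible finite-dimensional complex representations of $\Gamma$, with $\gamma_0$ trivial, and $\gamma$ is the natural representation of $\Gamma$ on $\mathbb{C}^3$. The matrix $A^{(1)}=(a^{(1)}_{ij})_{0\le i,j\le l}$ is defined by $\gamma_j\otimes\gamma=\bigoplus_{i=0}^l a^{(1)}_{ij}\gamma_i$. The generalized Cartan matrix attached to $\Gamma$ is $C_\Gamma:=2I-A^{(1)}-{}^tA^{(1)}+2\,\mathrm{Diag}(A^{(1)})$, where $\mathrm{Diag}(A^{(1)})$ is the diagonal matrix with the same diagonal entries as $A^{(1)}$. For $k\in\{0,\dots,l\}$, the simple reflection $s_k$ associated with the $k$-th simple root of the Kac-Moody algebra attached to $C_\Gamma$ is the $(l+1)\times(l+1)$ matrix $(s_k)_{ij}=\delta_{ij}-(C_\Gamma)_{k,j}\,\delta_{ik}$. $I$ is the identity matrix of size $l+1$. *)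

(* Defs.v *)
From HB Require Import structures.
From mathcomp Require Import all_boot all_order all_algebra all_fingroup.
From mathcomp Require Import mxrepresentation character.
From mathcomp Require Import finmap reals complex.

Set Implicit Arguments.
Unset Strict Implicit.
Unset Printing Implicit Defensive.

Import GRing.Theory.

Local Open Scope ring_scope.
Local Open Scope fset_scope.

Record finSL3 (F : fieldType) := FinSL3 {
  fsl3_set :> {fset 'M[F]_3};
  fsl3_one : 1%:M \in fsl3_set;
  fsl3_mul : {in fsl3_set &, forall x y, x *m y \in fsl3_set};
  fsl3_inv : {in fsl3_set, forall x, invmx x \in fsl3_set};
  fsl3_det : {in fsl3_set, forall x, \det x = 1} }.

(* The elements of the matrix group Gamma, made into a finGroupType whose    *)
(* law is matrix multiplication, so that mxrepresentation applies.           *)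
Definition fsl3_type (F : fieldType) (Gamma : finSL3 F) : Type :=
  fset_sub_type (fsl3_set Gamma).

HB.instance Definition _ (F : fieldType) (Gamma : finSL3 F) :=
  Finite.copy (fsl3_type Gamma) (fset_sub_type (fsl3_set Gamma)).

Definition fsl3_1 (F : fieldType) (Gamma : finSL3 F) : fsl3_type Gamma :=
  [` fsl3_one Gamma].

Definition fsl3_mulg (F : fieldType) (Gamma : finSL3 F)
    (x y : fsl3_type Gamma) : fsl3_type Gamma :=
  [` @fsl3_mul F Gamma _ _ (fsvalP x) (fsvalP y)].

Definition fsl3_invg (F : fieldType) (Gamma : finSL3 F)
    (x : fsl3_type Gamma) : fsl3_type Gamma :=
  [` @fsl3_inv F Gamma _ (fsvalP x)].

Fact fsl3_mulgA (F : fieldType) (Gamma : finSL3 F) :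
  associative (@fsl3_mulg F Gamma).
Proof. by move=> x y z; apply: val_inj; rewrite /= mulmxA. Qed.

Fact fsl3_mul1g (F : fieldType) (Gamma : finSL3 F) :
  left_id (fsl3_1 Gamma) (@fsl3_mulg F Gamma).
Proof. by move=> x; apply: val_inj; rewrite /= mul1mx. Qed.

Fact fsl3_mulVg (F : fieldType) (Gamma : finSL3 F) :
  left_inverse (fsl3_1 Gamma) (@fsl3_invg F Gamma) (@fsl3_mulg F Gamma).
Proof.
move=> x; apply: val_inj; rewrite /= mulVmx // unitmxE.
by rewrite (fsl3_det (fsvalP x)) unitr1.
Qed.

HB.instance Definition _ (F : fieldType) (Gamma : finSL3 F) :=
  Finite_isGroup.Build (fsl3_type Gamma)
    (@fsl3_mulgA F Gamma) (@fsl3_mul1g F Gamma) (@fsl3_mulVg F Gamma).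

Definition fsl3_group (F : fieldType) (Gamma : finSL3 F) :
  {group fsl3_type Gamma} := [set: fsl3_type Gamma]%G.

Fact natural_mx_repr (F : fieldType) (Gamma : finSL3 F) :
  mx_repr (fsl3_group Gamma) (fun x : fsl3_type Gamma => fsval x).
Proof. by split. Qed.

Definition natural_repr (F : fieldType) (Gamma : finSL3 F) :
  mx_representation F (fsl3_group Gamma) 3 :=
  MxRepresentation (natural_mx_repr Gamma).

(* gam 0, ..., gam l are representatives of the isomorphism classes of       *)
(* irreducible representations of G, with gam 0 the trivial one.             *)
Definition irr_representatives (F : fieldType) (gT : finGroupType)
    (G : {group gT}) (l : nat) (gam : 'I_l.+1 -> representation F G) : Prop :=
  [/\ forall i, mx_irreducible (gam i),
      forall i j, mx_rsim (gam i) (gam j) -> i = j,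
      forall (n : nat) (rG : mx_representation F G n),
        mx_irreducible rG -> exists i, mx_rsim rG (gam i)
    & rdegree (gam ord0) = 1%N /\ {in G, forall x, gam ord0 x = 1%:M}].

(* gam j (x) V is the direct sum over i of A i j copies of gam i.            *)
Definition tensor_multiplicities (F : fieldType) (gT : finGroupType)
    (G : {group gT}) (n : nat) (V : mx_representation F G n) (l : nat)
    (gam : 'I_l.+1 -> representation F G) (A : 'M[nat]_l.+1) : Prop :=
  forall j, mx_rsim (prod_repr (gam j) V)
    (\big[dadd_grepr/grepr0]_(i < l.+1) muln_grepr (gam i) (A i j)).

Definition cartan_mx (n : nat) (A : 'M[nat]_n) : 'M[int]_n :=
  let A1 : 'M[int]_n := map_mx Posz A in
  2%:Z *: 1%:M - A1 - A1^T + 2%:Z *: diag_mx (\row_i A1 i i).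

Definition simple_reflection (n : nat) (C : 'M[int]_n) (k : 'I_n) : 'M[int]_n :=
  \matrix_(i, j) ((i == j)%:Z - C k j * (i == k)%:Z).

Definition simple_reflections (n : nat) (C : 'M[int]_n) : {fset 'M[int]_n} :=
  [fset simple_reflection C k | k : 'I_n].

Definition orthogonal_decomposition (n : nat) (C : 'M[int]_n) (p : nat)
    (S : 'I_p -> {fset 'M[int]_n}) : Prop :=
  [/\ simple_reflections C = \big[fsetU/fset0]_(r < p) S r,
      forall r r', r != r' -> [disjoint S r & S r']
    & forall r i j, simple_reflection C i \in S r ->
        simple_reflection C j \in S r -> i != j -> C i j = 0].

Definition minimal_orthogonal_decomposition (n : nat) (C : 'M[int]_n) (p : nat)
    (S : 'I_p -> {fset 'M[int]_n}) : Prop :=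
  orthogonal_decomposition C S /\
  forall (q : nat) (T : 'I_q -> {fset 'M[int]_n}),
    orthogonal_decomposition C T -> (p <= q)%N.

(* Matrix multiplication is not commutative, so the product over the set S   *)
(* is specified as the product over some enumeration of S; quantifying over  *)
(* all such t covers every order of the factors.                             *)
Definition is_product (n : nat) (S : {fset 'M[int]_n.+1}) (t : 'M[int]_n.+1) :
    Prop :=
  exists2 e : seq 'M[int]_n.+1, perm_eq e (enum_fset S) & t = \prod_(s <- e) s.

(* Main.v *)
Require Import Defs.
From mathcomp Require Import all_boot all_order all_algebra all_fingroup.
From mathcomp Require Import mxrepresentation character.
From mathcomp Require Import finmap reals complex.

Set Implicit Arguments.
Unset Strict Implicit.
Unset Printing Implicit Defensive.

Import GRing.Theory.

Local Open Scope ring_scope.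

(** Write N_k = 1 - s_k: its k-th row is the k-th row of C, and all its other
    rows vanish.  Hence C is the sum of the N_k, and N_i N_j = C_ij E_ij C is
    zero when the simple roots i and j are orthogonal.  So expanding the
    product of the s_k = 1 - N_k over one orthogonal block leaves 1 minus the
    sum of the N_k, and summing over the p blocks gives p I - C.  The s_k are
    pairwise distinct because C has diagonal entries 2, so each N_k is counted
    exactly once. *)

(** Induction on [e]: with the head written as [1 - (1 - x)], the cross terms against the expanded
    tail are products of an earlier complement with a later one, hence zero. *)
Lemma prod_pairwise_orthogonal (R : pzRingType) (e : seq R) :
  pairwise (fun x y => (1 - x) * (1 - y) == 0) e ->
  \prod_(x <- e) x = 1 - \sum_(x <- e) (1 - x).
Proof.
elim: e => [|x e IHe] /=; first by rewrite !big_nil subr0.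
case/andP=> /allP xe /IHe IH; rewrite !big_cons IH.
have x_sum : (1 - x) * \sum_(y <- e) (1 - y) = 0.
  by rewrite big_distrr big_seq big1 //= => y /xe/eqP.
rewrite -{1}[x](subKr 1) [LHS]mulrBl mul1r mulrBr mulr1 x_sum subr0.
by rewrite [in RHS]opprD addrAC addrA.
Qed.

Lemma simple_reflection_complE (n : nat) (C : 'M[int]_n.+1) (k i j : 'I_n.+1) :
  (1 - simple_reflection C k) i j = C k j * (i == k)%:Z.
Proof. by rewrite !mxE natz subKr. Qed.

Lemma sum_simple_reflection_compl (n : nat) (C : 'M[int]_n.+1) :
  \sum_k (1 - simple_reflection C k) = C.
Proof.
apply/matrixP=> i j; rewrite summxE (bigD1 i) //= simple_reflection_complE.
rewrite eqxx mulr1 big1 ?addr0 // => k; rewrite simple_reflection_complE.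
by rewrite eq_sym => /negPf->; rewrite mulr0.
Qed.

Lemma simple_reflection_compl_mul0 (n : nat) (C : 'M[int]_n.+1)
    (i j : 'I_n.+1) :
  C i j = 0 -> (1 - simple_reflection C i) * (1 - simple_reflection C j) = 0.
Proof.
move=> Cij; apply/matrixP=> a b; rewrite mxE [RHS]mxE big1 // => k _.
rewrite !simple_reflection_complE; have [->|_] := eqVneq k j.
  by rewrite Cij !mul0r.
by rewrite !mulr0.
Qed.

(** The entry at [(i, i)] separates the reflections: it is [1 - C i i] in s_i and 1 in all others.
    So sets of reflections can stand for sets of simple roots. *)
Lemma simple_reflection_inj (n : nat) (C : 'M[int]_n) :
  (forall k, C k k != 0) -> injective (simple_reflection C).
Proof.
move=> C_neq0 i j /matrixP/(_ i i); rewrite !mxE !eqxx.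
have [// | _] := eqVneq i j; rewrite mulr1 mulr0 subr0 => /eqP.
by rewrite subr_eq addrC -subr_eq subrr eq_sym (negPf (C_neq0 i)).
Qed.

Lemma cartan_mx_diag (n : nat) (A : 'M[nat]_n) (k : 'I_n) :
  cartan_mx A k k = 2.
Proof.
(* Splitting the doubled diagonal term lets it cancel both [A] and its transpose. *)
rewrite !mxE !eqxx !mulr1n mulr1 -[2%:Z * _]/((1 + 1) * _) mulrDl mul1r.
by rewrite addrA !subrK.
Qed.

Lemma orthogonal_product_sum (n : nat) (C : 'M[int]_n.+1) (p : nat)
    (S : 'I_p -> {fset 'M[int]_n.+1}) (r : 'I_p) (t : 'M[int]_n.+1) :
  orthogonal_decomposition C S -> is_product (S r) t ->
  t = 1 - \sum_(s <- S r) (1 - s).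
Proof.
case=> Scover _ Sorth [e eS ->].
have S_refl s : s \in S r -> exists k, s = simple_reflection C k.
  move=> sS; suff /imfsetP[k _ ->] : s \in simple_reflections C by exists k.
  by rewrite Scover; apply/bigfcupP; exists r; rewrite ?mem_index_enum.
rewrite -(perm_big _ eS) /=; apply: prod_pairwise_orthogonal.
have e_uniq : uniq e by rewrite (perm_uniq eS) fset_uniq.
apply/(pairwiseP 0) => a b /=; rewrite !inE => ae be ab.
have := mem_nth 0 ae; have := mem_nth 0 be; rewrite !(perm_mem eS).
move=> /[dup] /S_refl[j ej] jS /[dup] /S_refl[i ei] iS.
(* Equal indices would put the same reflection at two positions [a < b] of the duplicate-free
   [e]. *)
have ij : i != j.
  apply: contraTneq ab => ij; rewrite -leqNgt.
  have /eqP := etrans ei (etrans (congr1 _ ij) (esym ej)).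
  by rewrite nth_uniq // => /eqP->.
rewrite ei ej in iS jS *.
by rewrite simple_reflection_compl_mul0 //; apply: Sorth iS jS ij.
Qed.

Lemma sum_orthogonal_decomposition (n : nat) (C : 'M[int]_n.+1) (p : nat)
    (S : 'I_p -> {fset 'M[int]_n.+1}) :
  (forall k, C k k != 0) -> orthogonal_decomposition C S ->
  \sum_(r < p) \sum_(s <- S r) (1 - s) = C.
Proof.
move=> C_neq0 [Scover Sdisj _].
(* The sum over a disjoint union is indexed by a finite set, so the index type is recast as one. *)
have enumP : perm_eq (index_enum 'I_p) [fset r in 'I_p]%fset.
  apply: uniq_perm => [||r]; rewrite ?index_enum_uniq ?fset_uniq //.
  by rewrite mem_index_enum !inE.
rewrite (perm_big _ enumP) /= -partition_disjoint_bigfcup; last first.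
  by move=> r r' _ _; apply: Sdisj.
(* The union of the blocks is the image of all indices under an injective map, so the sum over it
   becomes a sum over [k]. *)
rewrite -(perm_big _ enumP) /= -Scover big_imfset /=; last first.
  by move=> i j _ _; apply: simple_reflection_inj.
by rewrite big_enum sum_simple_reflection_compl.
Qed.

Theorem mainTheorem3 (R : realType) (Gamma : finSL3 R[i]) (l : nat)
    (gam : 'I_l.+1 -> representation R[i] (fsl3_group Gamma))
    (A : 'M[nat]_l.+1)
    (hgam : irr_representatives gam)
    (hA : tensor_multiplicities (natural_repr Gamma) gam A)
    (p : nat) (S : 'I_p -> {fset 'M[int]_l.+1})
    (hS : minimal_orthogonal_decomposition (cartan_mx A) S)
    (tau : 'I_p -> 'M[int]_l.+1)
    (htau : forall r, is_product (S r) (tau r)) :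
  cartan_mx A = p%:Z *: 1%:M - \sum_(r < p) tau r.
Proof.
have [decS _] := hS.
have C_neq0 k : cartan_mx A k k != 0 by rewrite cartan_mx_diag.
rewrite (eq_bigr _ (fun r _ => orthogonal_product_sum decS (htau r))).
rewrite sumrB (sum_orthogonal_decomposition C_neq0 decS) sumr_const card_ord.
by rewrite -natz scaler_nat subKr.
Qed.
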